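(* Let $\epsilon>0$, let $M\ge 1$ be an integer and $N=4M$. Let $y_j=(\cos\varphi_j,\sin\varphi_j)$, $j=1,\dots,N$, be distinct points of the unit circle such that $-\epsilon<\varphi_j<\epsilon$ for $j=1,\dots,M$, and such that the set $\{y_1,\dots,y_N\}$ consists of $y_1,\dots,y_M$ together with their rotations about the origin by $\pi/2,\pi,3\pi/2$, with $y_{M+1},\dots,y_{2M}$ being the rotations of $y_1,\dots,y_M$ by $\pi/2$. Let $G$ be the stationary Gaussian field on $\mathbb{R}^2$ $$G(x)=\frac{\sqrt2}{2}\Big[\sum_{j=1}^{2M}b_j\cos\langle x,y_j\rangle+\sum_{j=1}^{2M}c_j\sin\langle x,y_j\rangle\Big],$$ where $b_j,c_j$ ($j=1,\dots,2M$) are i.i.d. centred real Gaussians of variance $4/N$ (so the spectral measure of $G$ is purely atomic, with $N$ atoms of equal mass at the points $y_j$). Let $F$ be the Cilleruelo field. Then there is an absolute constant $c>0$ (independent of $\epsilon$, $M$, the points $y_j$ and $R$) and a coupling of the fields $F$ and $G$ (a realisation of both on one probability space with the prescribed marginal laws) such that for all $R\ge 2c$ $$\mathbb{P}\big[\|F-G\|_{C(B_R)}\ge 2\epsilon R\log R\big]\le \exp(-\log^2 R/c)$$ and $$\mathbb{P}\big[\|F-G\|_{C(B_R)}\ge 2\epsilon R^2\big]\le \exp(-R^2/c).$$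
   Context: The Cilleruelo field is the Gaussian field on $\mathbb{R}^2$ given by $F(x)=\frac{\sqrt2}{2}[\beta_1\cos x_1+\gamma_1\sin x_1+\beta_2\cos x_2+\gamma_2\sin x_2]$, where $\beta_1,\beta_2,\gamma_1,\gamma_2$ are i.i.d. standard real Gaussians. $B_R$ is the disc of radius $R$ centred at the origin in $\mathbb{R}^2$ and $\|h\|_{C(B_R)}=\sup_{x\in B_R}|h(x)|$. In the spectral representation used here, a field with spectral measure $\mu$ has covariance $\int e^{i\langle x-y,z\rangle}d\mu(z)$. *)

(* Defs.v *)
From HB Require Import structures.
From mathcomp Require Export all_boot all_order all_algebra.
From mathcomp Require Export all_classical all_reals all_analysis.
Export Order.TTheory GRing.Theory Num.Theory.
Export numFieldNormedType.Exports.

Set Implicit Arguments.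
Unset Strict Implicit.
Unset Printing Implicit Defensive.

Local Open Scope classical_set_scope.
Local Open Scope ring_scope.

Section Plane.
Variable R : realType.
Implicit Types (x y v : 'rV[R]_2) (r theta : R).

Definition coord1 x : R := x ord0 ord0.
Definition coord2 x : R := x ord0 ord_max.

Definition point (a b : R) : 'rV[R]_2 :=
  \row_(i < 2) (if i == ord0 then a else b).

Definition dot x y : R := coord1 x * coord1 y + coord2 x * coord2 y.

(* The Euclidean disc; the library's norm on 'rV[R]_2 is the maximum norm. *)
Definition disc r : set 'rV[R]_2 := [set x | Num.sqrt (dot x x) <= r].

Definition circle_point theta : 'rV[R]_2 := point (cos theta) (sin theta).

Definition rotation theta v : 'rV[R]_2 :=
  point (cos theta * coord1 v - sin theta * coord2 v)
        (sin theta * coord1 v + cos theta * coord2 v).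

(* ||h||_{C(B_r)}, in [0, +oo] (-oo when the disc is empty, i.e. for r < 0). *)
Definition C_norm r (h : 'rV[R]_2 -> R) : \bar R :=
  ereal_sup [set `|h x|%:E | x in disc r].

End Plane.

Section Gaussian.
Context {R : realType} {d : measure_display} {T : measurableType d}.
Variable P : probability T R.

Definition mutually_independent (I : finType) (X : I -> {RV P >-> R}) : Prop :=
  forall (J : {set I}) (A : I -> set R), (forall i, measurable (A i)) ->
    P (\bigcap_(i in [set` J]) X i @^-1` A i)
    = (\prod_(i in J) P (X i @^-1` A i))%E.

(* The second argument of normal_prob is the standard deviation.  The laws are
   compared on measurable sets only: outside of them the values of the library's
   measures carry no information. *)
Definition iid_centred_gaussian (variance : R) (I : finType)
    (X : I -> {RV P >-> R}) : Prop :=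
  mutually_independent X /\
  (forall (i : I) (A : set R), measurable A ->
     distribution P (X i) A = normal_prob 0 (Num.sqrt variance) A).

Definition join_families (I J : Type) (X : I -> {RV P >-> R})
    (Y : J -> {RV P >-> R}) (k : I + J) : {RV P >-> R} :=
  match k with inl i => X i | inr j => Y j end.

Definition cilleruelo_field (F : T -> 'rV[R]_2 -> R) : Prop :=
  exists beta gamma : 'I_2 -> {RV P >-> R},
    iid_centred_gaussian 1 (join_families beta gamma) /\
    forall (w : T) (x : 'rV[R]_2),
      F w x = Num.sqrt 2 / 2 *
        (beta ord0 w * cos (coord1 x) + gamma ord0 w * sin (coord1 x)
         + beta ord_max w * cos (coord2 x) + gamma ord_max w * sin (coord2 x)).

(* z lists one frequency of each antipodal pair of atoms of the spectral measure. *)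
Definition trigonometric_field (variance : R) (n : nat) (z : 'I_n -> 'rV[R]_2)
    (G : T -> 'rV[R]_2 -> R) : Prop :=
  exists b c : 'I_n -> {RV P >-> R},
    iid_centred_gaussian variance (join_families b c) /\
    forall (w : T) (x : 'rV[R]_2),
      G w x = Num.sqrt 2 / 2 *
        ((\sum_(j < n) b j w * cos (dot x (z j)))
         + (\sum_(j < n) c j w * sin (dot x (z j)))).

End Gaussian.

Lemma leq_2M_4M (M : nat) : (2 * M <= 4 * M)%N.
Proof. by rewrite leq_mul2r orbT. Qed.

(* Main.v *)
Require Import Defs.
From mathcomp Require Import measurable_realfun zify ring lra.

(** Take [4 M] independent centred Gaussians of variance [1 / M] and group them
into four blocks of [M]: the cosine and the sine coefficients at the frequencies
close to [(1, 0)], and those at the frequencies close to [(0, 1)]. The sum over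
a block is standard normal and the four sums are independent, so the sums can
serve as the coefficients of the field [F] while the Gaussians themselves are
the coefficients of [G]. This is the coupling.

For this coupling, [F - G] is a linear combination of the [4 M] Gaussians, with
coefficients at [x] of the form [cos x_1 - cos <x, y_j>]. A frequency at angle
less than [eps] from its axis satisfies
[|x_1 - <x, y_j>| <= eps (|x_1| + |x_2|)], so in the square of half-side [r]
the coefficients are [O(eps r)] and their increments between [x] and [x'] are
[O(eps r |x - x'|)] ([coef_le], [coef_increment]). As the Gaussians have total
variance 4, the values and the increments of [F - G] are centred Gaussians with
standard deviations of the same orders, whatever [M] is. (Bounding the supremum
by the sum of the absolute values of the Gaussians would lose a factor of order
[sqrt M].)

Chaining turns these pointwise bounds into a bound on the supremum
([sup_tail]). Round the coordinates of a point to multiples of [2 ^- k], for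
every [k]. The increment between two consecutive roundings exceeds
[eps r s (3/4)^k / 8] with probability at most [2 exp (- s^2 (9/4)^k / C)], and
there are [O(4^k r^2)] such increments to control. Once [s] is larger than an
absolute constant and [r <= exp s], the Gaussian decay beats the number of
increments, and the bounds sum over [k]; off the exceptional event the
increments add up to at most [eps r s], half of what is allowed. The choices
[s = ln r] and [s = r] give the two estimates.

The probability space is a finite product of normal laws on the line. Three
properties pass through products together ([gaussian_system]): independence with
the prescribed marginals, the joint moment generating function (by Tonelli), and
the law of the sum (by convolution of normal laws). The second one gives the
tails of linear combinations ([gaussian_tail]), the third one the law of the
block sums. *)

Set Implicit Arguments.
Unset Strict Implicit.
Unset Printing Implicit Defensive.

Local Open Scope classical_set_scope.
Local Open Scope ring_scope.

(** * Normal laws on the line *)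

Section Normal.
Variable R : realType.
Local Notation mu := (@lebesgue_measure R).
Implicit Types (s t a x : R).

(** The density of the law is its Radon-Nikodym derivative, by uniqueness of the
latter up to null sets. *)
Lemma integral_normal_prob m s (f : R -> \bar R) :
  measurable_fun setT f -> (forall x, (0 <= f x)%E) ->
  (\int[normal_prob m s]_x f x = \int[mu]_x (f x * (normal_pdf m s x)%:E))%E.
Proof.
move=> mf f0.
have dom := normal_prob_dominates m s.
rewrite -(Radon_Nikodym_SigmaFinite.change_of_variables dom)//.
have iRN := Radon_Nikodym_SigmaFinite.f_integrable dom.
have mpdf : measurable_fun setT (fun x => (normal_pdf m s x)%:E).
  by apply/measurable_EFinP; exact: measurable_normal_pdf.
apply: ae_eq_integral => //.
- by apply: emeasurable_funM => //; exact: measurable_int iRN.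
- exact: emeasurable_funM.
- apply: ae_eqe_mul2l; apply: integral_ae_eq => //.
  by move=> A _ mA; rewrite -Radon_Nikodym_SigmaFinite.f_integral.
Qed.

Lemma integral_translation a (f : R -> \bar R) :
  measurable_fun setT f -> (forall x, (0 <= f x)%E) ->
  (\int[mu]_x f (x + a)%R = \int[mu]_x f x)%E.
Proof.
move=> mf f0.
pose shift_a := (fun x : R => x + a) : measurableTypeR R -> measurableTypeR R.
have mshift : measurable_fun setT shift_a by exact: measurable_funD.
transitivity (\int[pushforward mu shift_a]_x f x)%E.
  by rewrite ge0_integral_pushforward.
apply: eq_measure_integral => //= A mA _.
apply/esym/lebesgue_measure_unique => //= _ [[u v] _ <-].
rewrite /pushforward /=.
have -> : (fun x : R => x + a) @^-1` `]u, v] = `]u - a, v - a]%classic.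
  by apply/seteqP; split => x /=; rewrite !in_itv/= ltrBlDr lerBrDr.
rewrite !lebesgue_measure_itv/= !lte_fin ltrD2r.
by case: ifP => // _; rewrite -!EFinB; congr EFin; ring.
Qed.

(** Completing the square: an exponential weight moves the mean and contributes a
constant factor, which is the moment generating function. *)
Lemma normal_pdf_tilt s a x : s != 0 ->
  expR (a * x) * normal_pdf 0 s x
  = expR (s ^+ 2 * a ^+ 2 / 2) * normal_pdf (s ^+ 2 * a) s x.
Proof.
move=> s0; rewrite !normal_pdfE// /normal_fun mulrCA [RHS]mulrCA.
congr (_ * _); rewrite -!expRD; congr expR.
by field; rewrite s0.
Qed.

Lemma normal_prob_mgf s a : s != 0 ->
  (\int[normal_prob 0 s]_x (expR (a * x))%:E
   = (expR (s ^+ 2 * a ^+ 2 / 2))%:E)%E.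
Proof.
move=> s0; rewrite integral_normal_prob//=.
under eq_integral do rewrite -EFinM normal_pdf_tilt// EFinM.
rewrite ge0_integralZl//.
- by rewrite integral_normal_pdf mule1.
- by apply/measurable_EFinP; exact: measurable_normal_pdf.
- by move=> x _; rewrite lee_fin normal_pdf_ge0.
- by apply/measurable_EFinP; apply: measurableT_comp => //; exact: mulrl_measurable.
Qed.

(** Completing the square in [x] factors the joint density of [x] and of a normal
variable centred at [x] into the density of the latter variable and the
conditional density of [x] given it. *)
Lemma normal_pdf_mul s t x z : 0 < s -> 0 < t ->
  normal_pdf 0 s x * normal_pdf x t z
  = normal_pdf 0 (Num.sqrt (s ^+ 2 + t ^+ 2)) z
    * normal_pdf (z * s ^+ 2 / (s ^+ 2 + t ^+ 2))
        (s * t / Num.sqrt (s ^+ 2 + t ^+ 2)) x.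
Proof.
move=> s0 t0; set u := Num.sqrt _.
have st0 : 0 < s ^+ 2 + t ^+ 2 by rewrite addr_gt0 ?exprn_gt0.
have u0 : 0 < u by rewrite sqrtr_gt0.
have u2 : s ^+ 2 + t ^+ 2 = u ^+ 2 by rewrite sqr_sqrtr// ltW.
have st_u : 0 < s * t / u by rewrite divr_gt0 ?mulr_gt0.
rewrite !normal_pdfE ?gt_eqF// /normal_fun mulrACA [RHS]mulrACA.
congr (_ * _).
  rewrite /normal_peak -!invfM -!sqrtrM ?mulrn_wge0 ?mulr_ge0 ?sqr_ge0 ?pi_ge0
    ?(ltW u0) ?(ltW s0)//.
  by congr (Num.sqrt _)^-1; field; rewrite gt_eqF.
rewrite -!expRD; congr expR; rewrite expr_div_n exprMn -u2.
by field; rewrite !gt_eqF.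
Qed.

Lemma normal_pdf_shift t x z : t != 0 -> normal_pdf x t (z + x) = normal_pdf 0 t z.
Proof. by move=> t0; rewrite !normal_pdfE// /normal_fun addrK subr0. Qed.

Lemma normal_probE m s (A : set R) :
  normal_prob m s A = (\int[mu]_z (normal_pdf m s z * \1_A z)%:E)%E.
Proof.
rewrite /normal_prob integral_mkcond; apply: eq_integral => z _.
by rewrite /patch indicE; case: ifP => _; rewrite ?mulr1 ?mulr0.
Qed.

Lemma normal_prob_translate t x (A : set R) : t != 0 -> measurable A ->
  normal_prob 0 t [set y | A (x + y)] = normal_prob x t A.
Proof.
move=> t0 mA; rewrite !normal_probE.
rewrite -(@integral_translation x (fun z => (normal_pdf x t z * \1_A z)%:E)).
- apply: eq_integral => z _; rewrite normal_pdf_shift// !indicE.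
  congr (_ * _%:R)%:E; congr nat_of_bool.
  by apply/idP/idP; rewrite !inE /= addrC.
- apply/measurable_EFinP; apply: measurable_funM.
    exact: measurable_normal_pdf.
  exact: measurable_indic.
- by move=> z; rewrite lee_fin mulr_ge0 ?normal_pdf_ge0.
Qed.

(** Joint measurability in the mean and in the variable, which Tonelli's theorem
requires, comes from translating to mean zero. *)
Lemma measurable_normal_pdf_mean t : t != 0 ->
  measurable_fun setT (fun p : measurableTypeR R * measurableTypeR R =>
    normal_pdf p.1 t p.2).
Proof.
move=> t0; rewrite [X in measurable_fun _ X](_ : _ =
    fun p => normal_pdf 0 t (p.2 - p.1)); last first.
  by apply/funext => p; rewrite -(@normal_pdf_shift t p.1) ?subrK.
apply: measurableT_comp; first exact: measurable_normal_pdf.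
exact: measurable_funB.
Qed.

Lemma measurable_normal_pdf_indic t (A : set R) : t != 0 -> measurable A ->
  measurable_fun setT (fun p : measurableTypeR R * measurableTypeR R =>
    (normal_pdf p.1 t p.2 * \1_A p.2)%:E).
Proof.
move=> t0 mA; apply/measurable_EFinP; apply: measurable_funM.
  exact: measurable_normal_pdf_mean.
by apply: measurableT_comp => //; exact: measurable_indic.
Qed.

Lemma measurable_normal_prob_mean t (A : set R) : t != 0 -> measurable A ->
  measurable_fun setT (fun x : measurableTypeR R => normal_prob x t A).
Proof.
move=> t0 mA; under eq_fun do rewrite normal_probE.
apply: measurable_fun_fubini_tonelli_F (measurable_normal_pdf_indic t0 mA) _.
by move=> p; rewrite lee_fin mulr_ge0 ?normal_pdf_ge0.
Qed.

(** A normal variable with a normal mean is normal, and the variances add up: after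
Tonelli, the factorization [normal_pdf_mul] lets the mean be integrated out. *)
Lemma normal_prob_conv s t (A : set R) : 0 < s -> 0 < t -> measurable A ->
  (\int[normal_prob 0 s]_x normal_prob x t A
   = normal_prob 0 (Num.sqrt (s ^+ 2 + t ^+ 2)) A)%E.
Proof.
move=> s0 t0 mA; set u := Num.sqrt _.
have tn0 : t != 0 by rewrite gt_eqF.
have u0 : 0 < u by rewrite sqrtr_gt0 addr_gt0 ?exprn_gt0.
have mk := measurable_normal_pdf_indic tn0 mA.
set k := (X in measurable_fun _ X) in mk.
pose h p : \bar R := (k p * (normal_pdf 0 s p.1)%:E)%E.
have k0 p : (0 <= k p)%E by rewrite lee_fin mulr_ge0 ?normal_pdf_ge0.
have h0 p : (0 <= h p)%E by rewrite mule_ge0// lee_fin normal_pdf_ge0.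
have mh : measurable_fun setT h.
  apply: emeasurable_funM => //; apply/measurable_EFinP.
  by apply: measurableT_comp => //; exact: measurable_normal_pdf.
transitivity (\int[mu]_x \int[mu]_z h (x, z))%E.
  rewrite integral_normal_prob//; last exact: measurable_normal_prob_mean.
  apply: eq_integral => x _; rewrite normal_probE -ge0_integralZr//.
  - exact: measurableT_comp mk (pair1_measurable x).
  - by move=> z _; exact: (k0 (x, z)).
  - by rewrite lee_fin normal_pdf_ge0.
rewrite (fubini_tonelli h)//= normal_probE.
apply: eq_integral => z _.
pose c := normal_pdf 0 u z * \1_A z.
under eq_integral => x _.
  rewrite /h /k /= -EFinM mulrAC [X in X * _]mulrC normal_pdf_mul// -/u.
  rewrite mulrAC -/c EFinM; over.
rewrite ge0_integralZl ?integral_normal_pdf ?mule1//.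
- by apply/measurable_EFinP; exact: measurable_normal_pdf.
- by move=> x _; rewrite lee_fin normal_pdf_ge0.
- by rewrite lee_fin mulr_ge0 ?normal_pdf_ge0.
Qed.
End Normal.

(** * Random variables on a product of two probability spaces *)

Section Systems.
Context {R : realType}.

Definition rv_of d (T : measurableType d) (P : probability T R) (f : T -> R)
  (mf : measurable_fun setT f) : {RV P >-> R} := mfun_Sub (mem_set mf).

Section Lift.
Context {d1 d2} {T1 : measurableType d1} {T2 : measurableType d2}.
Variables (P1 : probability T1 R) (P2 : probability T2 R).

Definition prod_prob : probability (T1 * T2)%type R := (P1 \x P2)%E.

Definition lift1 (X : {RV P1 >-> R}) : {RV prod_prob >-> R} :=
  rv_of prod_prob (measurableT_comp (measurable_funPT X) (@measurable_fst _ _ T1 T2)).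
Definition lift2 (Y : {RV P2 >-> R}) : {RV prod_prob >-> R} :=
  rv_of prod_prob (measurableT_comp (measurable_funPT Y) (@measurable_snd _ _ T1 T2)).

Definition join_prod (I1 I2 : Type) (X : I1 -> {RV P1 >-> R})
    (Y : I2 -> {RV P2 >-> R}) : I1 + I2 -> {RV prod_prob >-> R} :=
  join_families (fun i => lift1 (X i)) (fun j => lift2 (Y j)).

Lemma prod_prob_fst (A : set T1) : measurable A -> prod_prob (A `*` setT) = P1 A.
Proof.
by move=> mA; rewrite [LHS]product_measure1E// [X in (_ * X)%E]probability_setT mule1.
Qed.

Lemma prod_prob_snd (A : set T2) : measurable A -> prod_prob (setT `*` A) = P2 A.
Proof.
by move=> mA; rewrite [LHS]product_measure1E// [X in (X * _)%E]probability_setT mul1e.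
Qed.

Lemma lift1_preimage X (A : set R) : lift1 X @^-1` A = (X @^-1` A) `*` setT.
Proof. by apply/seteqP; split => [[x y]|[x y] []] /=. Qed.

Lemma lift2_preimage Y (A : set R) : lift2 Y @^-1` A = setT `*` (Y @^-1` A).
Proof. by apply/seteqP; split => [[x y]|[x y] []] /=. Qed.

Lemma prod_prob_lift1 X (A : set R) : measurable A ->
  prod_prob (lift1 X @^-1` A) = P1 (X @^-1` A).
Proof.
by move=> mA; rewrite lift1_preimage prod_prob_fst//; exact: measurable_funPTI.
Qed.

Lemma prod_prob_lift2 Y (A : set R) : measurable A ->
  prod_prob (lift2 Y @^-1` A) = P2 (Y @^-1` A).
Proof.
by move=> mA; rewrite lift2_preimage prod_prob_snd//; exact: measurable_funPTI.
Qed.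

Lemma measurable_cylinder d (T : measurableType d) (P : probability T R)
  (I : finType) (X : I -> {RV P >-> R}) (J : {set I}) (A : I -> set R) :
  (forall i, measurable (A i)) ->
  measurable (\bigcap_(i in [set` J]) X i @^-1` A i).
Proof.
move=> mA; apply: fin_bigcap_measurable; first exact: finite_finset.
by move=> i _; exact: measurable_funPTI.
Qed.

(** A cylinder event of the joined family is a rectangle. *)
Lemma independent_prod (I1 I2 : finType) (X : I1 -> {RV P1 >-> R})
    (Y : I2 -> {RV P2 >-> R}) :
  mutually_independent X -> mutually_independent Y ->
  mutually_independent (join_prod X Y).
Proof.
move=> indX indY J A mA.
pose J1 := [set i | inl i \in J]%SET; pose J2 := [set i | inr i \in J]%SET.
have -> : \bigcap_(i in [set` J]) join_prod X Y i @^-1` A i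
    = (\bigcap_(i in [set` J1]) X i @^-1` A (inl i))
      `*` (\bigcap_(i in [set` J2]) Y i @^-1` A (inr i)).
  apply/seteqP; split => [[x y] /= H|[x y] /= [H1 H2]].
    by split => i /=; rewrite inE => iJ; exact: (H _ iJ).
  by case=> i /= iJ; [apply: H1|apply: H2]; rewrite /= inE.
rewrite [LHS]product_measure1E; [|exact: measurable_cylinder..].
rewrite big_sumType /=; congr (_ * _)%E; [rewrite [LHS]indX//|rewrite [LHS]indY//].
- by apply: eq_big => [i|i _]; rewrite ?inE// -prod_prob_lift1.
- by apply: eq_big => [i|i _]; rewrite ?inE// -prod_prob_lift2.
Qed.

Lemma iid_prod (v : R) (I1 I2 : finType) (X : I1 -> {RV P1 >-> R})
    (Y : I2 -> {RV P2 >-> R}) :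
  iid_centred_gaussian v X -> iid_centred_gaussian v Y ->
  iid_centred_gaussian v (join_prod X Y).
Proof.
move=> [indX lawX] [indY lawY]; split; first exact: independent_prod.
by case=> i A mA /=; [rewrite -(lawX i)//; exact: prod_prob_lift1
                     |rewrite -(lawY i)//; exact: prod_prob_lift2].
Qed.

(** The joint moment generating function of independent centred Gaussians of
variance [v]. It is kept as a separate property because it passes to products
directly, whereas its derivation from independence of events would need
factorization of expectations. *)
Definition gaussian_mgf d (T : measurableType d) (P : probability T R)
    (v : R) (I : finType) (X : I -> {RV P >-> R}) : Prop :=
  forall a : I -> R,
  (\int[P]_w (expR (\sum_i a i * X i w))%:E
   = (expR (v * (\sum_i a i ^+ 2) / 2))%:E)%E.

Lemma measurable_lincomb d (T : measurableType d) (P : probability T R)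
    (I : finType) (X : I -> {RV P >-> R}) (a : I -> R) :
  measurable_fun setT (fun w => \sum_i a i * X i w).
Proof.
apply: measurable_sum => i; apply: measurableT_comp => //.
Qed.

(** The exponential of a sum over both factors is a product, which Tonelli's theorem
integrates factor by factor. *)
Lemma mgf_prod (v : R) (I1 I2 : finType) (X : I1 -> {RV P1 >-> R})
    (Y : I2 -> {RV P2 >-> R}) :
  gaussian_mgf v X -> gaussian_mgf v Y -> gaussian_mgf v (join_prod X Y).
Proof.
move=> mX mY a.
pose f w := expR (\sum_i a (inl i) * X i w).
pose g w := expR (\sum_i a (inr i) * Y i w).
have mf : measurable_fun setT f.
  by apply: measurableT_comp => //; exact: measurable_lincomb.
have mg : measurable_fun setT g.
  by apply: measurableT_comp => //; exact: measurable_lincomb.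
under eq_integral => w _.
  rewrite big_sumType /= expRD -/(f w.1) -/(g w.2); over.
rewrite /prod_prob /= fubini_tonelli1; first last.
- by move=> w; rewrite lee_fin mulr_ge0 ?expR_ge0.
- apply/measurable_EFinP; apply: measurable_funM; exact: measurableT_comp.
have intg x : (\int[P2]_y (f x * g y)%:E
    = (f x)%:E * (expR (v * (\sum_i a (inr i) ^+ 2) / 2))%:E)%E.
  rewrite -mY -ge0_integralZl//; first exact/measurable_EFinP.
  by rewrite lee_fin expR_ge0.
under eq_integral => x _ do rewrite /fubini_F /= intg.
rewrite ge0_integralZr//.
- rewrite mX -EFinM -expRD big_sumType /=; congr (expR _)%:E.
  by rewrite mulrDr mulrDl.
- exact/measurable_EFinP.
- by move=> x _; rewrite lee_fin expR_ge0.
Qed.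

Definition gaussian_sum d (T : measurableType d) (P : probability T R)
    (v : R) (I : finType) (X : I -> {RV P >-> R}) : Prop :=
  forall A : set R, measurable A ->
  P [set w | A (\sum_i X i w)] = normal_prob 0 (Num.sqrt (v * #|I|%:R)) A.

Lemma measurable_rv_sum d (T : measurableType d) (P : probability T R)
    (I : finType) (X : I -> {RV P >-> R}) :
  measurable_fun setT (fun w => \sum_i X i w).
Proof. exact: measurable_sum. Qed.

(** Given the first factor, the total sum is normal with mean the first sum; hence
[normal_prob_conv] applies. *)
Lemma sum_prod (v : R) (I1 I2 : finType) (X : I1 -> {RV P1 >-> R})
    (Y : I2 -> {RV P2 >-> R}) : 0 < v -> (0 < #|I1|)%N -> (0 < #|I2|)%N ->
  gaussian_sum v X -> gaussian_sum v Y -> gaussian_sum v (join_prod X Y).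
Proof.
move=> v0 I10 I20 lawX lawY A mA.
pose U := rv_of P1 (measurable_rv_sum X).
have s0 : 0 < Num.sqrt (v * #|I1|%:R) by rewrite sqrtr_gt0 mulr_gt0 ?ltr0n.
have t0 : 0 < Num.sqrt (v * #|I2|%:R) by rewrite sqrtr_gt0 mulr_gt0 ?ltr0n.
set s := Num.sqrt _ in s0; set t := Num.sqrt _ in t0.
have tn0 : t != 0 by rewrite gt_eqF.
(* The Borel structure under which the normal law is a measure is not the
   canonical one of the line, although the measurable sets are the same. *)
have mU : measurable_fun setT (U : T1 -> measurableTypeR R).
  exact: (measurable_funPT U).
transitivity (\int[P1]_x normal_prob (U x) t A)%E.
  rewrite /prod_prob /= /product_measure1; apply: eq_integral => x _ /=.
  rewrite -normal_prob_translate// -lawY; last first.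
    rewrite -[X in measurable X]setTI.
    by apply: (_ : measurable_fun setT (fun y : R => U x + y)) => //;
      exact: measurable_funD.
  congr (P2 _); apply/seteqP; split => y /=;
    by rewrite /xsection /= inE /= big_sumType.
transitivity (\int[pushforward P1 (U : T1 -> measurableTypeR R)]_x
    normal_prob x t A)%E.
  rewrite ge0_integral_pushforward//.
  exact: measurable_normal_prob_mean.
rewrite card_sum natrD mulrDr -[v * #|I1|%:R]sqr_sqrtr; last first.
  by rewrite mulr_ge0// ltW.
rewrite -[v * #|I2|%:R]sqr_sqrtr; last by rewrite mulr_ge0// ltW.
rewrite -/s -/t -normal_prob_conv//.
apply: eq_measure_integral => // B mB _.
exact: lawX.
Qed.

End Lift.
End Systems.

(** * Independent Gaussians with exponential moments *)

Section Construction.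
Context {R : realType}.

Record gaussian_system d (T : measurableType d) (P : probability T R)
    (v : R) (I : finType) (X : I -> {RV P >-> R}) : Prop := GaussianSystem {
  system_iid : iid_centred_gaussian v X ;
  system_mgf : gaussian_mgf v X ;
  system_sum : gaussian_sum v X }.

Lemma system_prod d1 d2 (T1 : measurableType d1) (T2 : measurableType d2)
    (P1 : probability T1 R) (P2 : probability T2 R) (v : R) (I1 I2 : finType)
    (X : I1 -> {RV P1 >-> R}) (Y : I2 -> {RV P2 >-> R}) :
  0 < v -> (0 < #|I1|)%N -> (0 < #|I2|)%N ->
  gaussian_system v X -> gaussian_system v Y ->
  gaussian_system v (join_prod X Y).
Proof.
move=> v0 I10 I20 [iX mX sX] [iY mY sY].
by split; [exact: iid_prod|exact: mgf_prod|exact: sum_prod].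
Qed.

Section Reindex.
Context d (T : measurableType d) (P : probability T R) (v : R).
Variables (I J : finType) (X : I -> {RV P >-> R}) (f : J -> I).

(** Constraints on the reindexed family are constraints on the original one, where
the indices outside of the image are left free. *)
Lemma iid_reindex : injective f ->
  iid_centred_gaussian v X -> iid_centred_gaussian v (fun j => X (f j)).
Proof.
move=> injf [ind law]; split; last by move=> j A mA; exact: law.
move=> K A mA.
pose B i := \bigcap_(j in [set j | f j = i]) A j.
have fB j : B (f j) = A j.
  by apply/seteqP; split => x /=; [apply|move=> Ax k /= /injf ->].
have mB i : measurable (B i).
  by apply: fin_bigcap_measurable => //; exact: finite_finset.
have := ind (f @: K)%SET B mB.
rewrite big_imset /=; last by move=> j k _ _; exact: injf.
under eq_bigr do rewrite fB.
move=> <-; congr (P _); apply/seteqP; split => w H i /=.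
  by move=> /imsetP[j jK ->]; rewrite fB; exact: H.
by move=> iK; rewrite -fB; apply: (H (f i)); rewrite /= imset_f.
Qed.

Lemma system_reindex : bijective f ->
  gaussian_system v X -> gaussian_system v (fun j => X (f j)).
Proof.
move=> bf [iX mX sX]; have [g fK gK] := bf; split.
- by apply: iid_reindex => //; exact: bij_inj.
- move=> a; rewrite [X in v * X](reindex g) /=; last by exists f => i _.
  rewrite -mX; apply: eq_integral => w _; congr (expR _)%:E.
  rewrite (reindex g) /=; last by exists f => i _.
  by apply: eq_bigr => i _; rewrite gK.
- move=> A mA; rewrite (bij_eq_card bf) -sX//; congr (P _).
  have sumE w : \sum_j X (f j) w = \sum_i X i w.
    rewrite (reindex g) /=; last by exists f => i _.
    by apply: eq_bigr => i _; rewrite gK.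
  by apply/seteqP; split => w /=; rewrite sumE.
Qed.
End Reindex.

Lemma independent_ord1 d (T : measurableType d) (P : probability T R)
    (X : 'I_1 -> {RV P >-> R}) : mutually_independent X.
Proof.
move=> J A mA; have [J0|J0] := boolP (ord0 \in J).
  rewrite (big_pred1 ord0); last by move=> i; rewrite (ord1 i) J0 /= eqxx.
  congr (P _); apply/seteqP; split => x /=; first exact.
  by move=> Ax i /=; rewrite (ord1 i).
rewrite big_pred0; last by move=> i; rewrite (ord1 i) (negbTE J0).
rewrite -[RHS](probability_setT P).
congr (P _); apply/seteqP; split => x //= _ i /=.
by rewrite (ord1 i) (negbTE J0).
Qed.

Definition coordinate (P : probability (measurableTypeR R) R) (_ : 'I_1) :
  {RV P >-> R} := rv_of P (@measurable_id _ R setT).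

Lemma system_ord1 (v : R) : 0 < v ->
  gaussian_system v (@coordinate (normal_prob 0 (Num.sqrt v))).
Proof.
move=> v0; have s0 : 0 < Num.sqrt v by rewrite sqrtr_gt0.
split.
- by split; first exact: independent_ord1.
- move=> a; under eq_integral do rewrite big_ord1.
  by rewrite normal_prob_mgf ?gt_eqF// sqr_sqrtr ?ltW// big_ord1.
- move=> A mA; rewrite card_ord mulr1; congr (normal_prob _ _ _).
  by apply/seteqP; split => x /=; rewrite big_ord1.
Qed.

Lemma system_exists (v : R) (n : nat) : 0 < v ->
  exists (d : measure_display) (T : measurableType d) (P : probability T R)
    (X : 'I_n.+1 -> {RV P >-> R}), gaussian_system v X.
Proof.
move=> v0; elim: n => [|n [d [T [P [X sX]]]]].
  by exists _, _, _, (@coordinate (normal_prob 0 (Num.sqrt v))); exact: system_ord1.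
pose f (i : 'I_n.+2) : 'I_n.+1 + 'I_1 := fintype.split (cast_ord (esym (addn1 _)) i).
have bf : bijective f.
  exists (fun u => cast_ord (addn1 _) (unsplit u)) => [i|u]; rewrite /f.
    by rewrite splitK cast_ordKV.
  by rewrite cast_ordK unsplitK.
exists _, _, _, (fun i => join_prod X (@coordinate (normal_prob 0 (Num.sqrt v))) (f i)).
apply: system_reindex bf _.
by apply: system_prod sX (system_ord1 v0) => //; rewrite card_ord.
Qed.

(** Chernoff's bound with the optimal parameter [t / s ^+ 2], applied to the linear
combination and to its opposite. *)
Lemma gaussian_tail d (T : measurableType d) (P : probability T R)
    (v : R) (I : finType) (X : I -> {RV P >-> R}) (a : I -> R) (s t : R) :
  gaussian_mgf v X -> 0 < s -> 0 < t -> v * (\sum_i a i ^+ 2) <= s ^+ 2 ->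
  (P [set w | (t <= `|\sum_i a i * X i w|)%R]
   <= (2 * expR (- (t ^+ 2 / (2 * s ^+ 2))))%:E)%E.
Proof.
move=> mX s0 t0 vs.
have one (b : I -> R) : v * (\sum_i b i ^+ 2) <= s ^+ 2 ->
    (P [set w | (t <= \sum_i b i * X i w)%R]
     <= (expR (- (t ^+ 2 / (2 * s ^+ 2))))%:E)%E.
  move=> vb; pose r := t / s ^+ 2.
  have r0 : 0 < r by rewrite divr_gt0 ?exprn_gt0.
  have := chernoff (rv_of P (measurable_lincomb X b)) t r0.
  move=> /le_trans; apply; rewrite /mmt_gen_fun unlock.
  under eq_integral => w _ do rewrite /= mulrC mulr_sumr.
  under eq_integral => w _ do under eq_bigr do rewrite mulrA.
  rewrite mX -EFinM -expRD lee_fin ler_expR.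
  have -> : \sum_i (r * b i) ^+ 2 = r ^+ 2 * \sum_i b i ^+ 2.
    by rewrite mulr_sumr; apply: eq_bigr => i _; rewrite exprMn.
  have -> : - (t ^+ 2 / (2 * s ^+ 2)) = s ^+ 2 * r ^+ 2 / 2 - r * t.
    by rewrite /r; field; rewrite gt_eqF.
  rewrite lerD2r ler_pM2r// mulrCA mulrC ler_wpM2r ?sqr_ge0//.
have mS (b : I -> R) : measurable [set w | t <= \sum_i b i * X i w].
  have -> : [set w | t <= \sum_i b i * X i w]
      = (fun w => \sum_i b i * X i w) @^-1` `[t, +oo[%classic.
    by apply/seteqP; split => w /=; rewrite in_itv/= andbT.
  rewrite -[X in measurable X]setTI.
  exact: (measurable_lincomb X b).
have -> : [set w | t <= `|\sum_i a i * X i w|]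
    = [set w | t <= \sum_i a i * X i w] `|` [set w | t <= \sum_i (- a i) * X i w].
  apply/seteqP; split => w /=; rewrite ler_normr.
    move=> /orP[->|]; [by left|right].
    by under eq_bigr do rewrite mulNr; rewrite sumrN.
  move=> [->//|]; under eq_bigr do rewrite mulNr.
  by rewrite sumrN => ->; rewrite orbT.
have PU := @measureU2 _ _ R P _ _ (mS a) (mS (fun i => - a i)).
apply: (le_trans PU).
rewrite mulr_natl mulr2n EFinD; apply: leeD; apply: one => //.
by under eq_bigr do rewrite sqrrN.
Qed.

End Construction.

(** * Dyadic rounding in the disc *)

Section Dyadic.
Variable R : realType.
Implicit Types (x y : 'rV[R]_2) (t r L e : R) (k m : nat).

(** A sign and an absolute value: rounding is towards zero, so that it never leaves
the disc. *)
Definition dyadic k (b : bool) m : R := (-1) ^+ b * (m%:R / 2 ^+ k).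

Definition dyadic_index k t : nat := Num.truncn (2 ^+ k * `|t|).

Definition dyadic_round k t : R := dyadic k (t < 0) (dyadic_index k t).

Let pow2_gt0 k : 0 < 2 ^+ k :> R. Proof. by rewrite exprn_gt0. Qed.

Lemma normr_dyadic k b m : `|dyadic k b m| = m%:R / 2 ^+ k.
Proof.
by rewrite /dyadic normrMsign ger0_norm// divr_ge0// ltW.
Qed.

Lemma normr_dyadic_round k t : `|dyadic_round k t| <= `|t|.
Proof.
rewrite normr_dyadic ler_pdivrMr// mulrC.
by rewrite truncn_le// mulr_ge0// ltW.
Qed.

Lemma dyadic_round_dist k t : `|t - dyadic_round k t| <= 2 ^- k.
Proof.
have -> : t - dyadic_round k t
    = (-1) ^+ (t < 0)%R * (`|t| - (dyadic_index k t)%:R / 2 ^+ k).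
  by rewrite mulrBr -numEsign.
rewrite normrMsign ger0_norm; last first.
  rewrite subr_ge0 ler_pdivrMr// mulrC truncn_le// mulr_ge0// ltW.
rewrite lerBlDr -[X in _ <= X + _]mul1r -mulrDl ler_pdivlMr// addrC mulrC natr1.
by rewrite ltW// truncnS_gt.
Qed.

(** Refining the rounding either keeps the point or moves it by one unit of the finer
grid, so the pairs of consecutive roundings are finitely many at each level. *)
Lemma dyadic_index_succ k t :
  exists d : bool, dyadic_index k.+1 t = (2 * dyadic_index k t + d)%N.
Proof.
set m := dyadic_index k t; set n := dyadic_index k.+1 t.
have t0 : 0 <= 2 ^+ k * `|t| by rewrite mulr_ge0// ltW.
have t0' : 0 <= 2 ^+ k.+1 * `|t| by rewrite mulr_ge0// ltW.
have /andP[m1 m2] := truncn_itv t0; have /andP[n1 n2] := truncn_itv t0'.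
rewrite -/m -/n in m1 m2 n1 n2.
have E : 2 ^+ k.+1 * `|t| = 2 * (2 ^+ k * `|t|) by rewrite exprS mulrA.
have mn : (2 * m <= n)%N.
  rewrite -ltnS -(ltr_nat R) natrM; apply: le_lt_trans n2; rewrite E.
  by rewrite ler_pM2l.
have nm : (n < 2 * m + 2)%N.
  rewrite -(ltr_nat R) natrD natrM; apply: le_lt_trans n1 _; rewrite E.
  by rewrite -[m.+1%:R]natr1 in m2; lra.
exists (n != 2 * m)%N.
by case: eqVneq => [->|ne]; lia.
Qed.

Lemma dyadic_double k b m : dyadic k.+1 b (2 * m) = dyadic k b m.
Proof.
by rewrite /dyadic natrM exprS -mulf_div divff ?mul1r.
Qed.

Lemma dyadic_step k b m (d : bool) :
  `|dyadic k.+1 b (2 * m + d) - dyadic k b m| <= 2 ^- k.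
Proof.
rewrite -[dyadic k b m]dyadic_double /dyadic -mulrBr normrMsign -mulrBl natrD addrAC subrr add0r.
rewrite normrM [X in _ * X]ger0_norm ?invr_ge0 ?(ltW (pow2_gt0 _))//.
apply: (@le_trans _ _ (1 * (2 ^+ k.+1)^-1)).
  by rewrite ler_wpM2r ?invr_ge0 ?(ltW (pow2_gt0 _))//; case: d; rewrite ?normr1 ?normr0.
by rewrite mul1r lef_pV2 ?posrE// exprS ler_peMl ?(ltW (pow2_gt0 _))// ler1n.
Qed.

Lemma pow2_small L e : 0 < e -> exists k, L * 2 ^- k < e.
Proof.
move=> e0; pose k := Num.bound (L / e); exists k.
rewrite ltr_pdivrMr// mulrC -ltr_pdivrMr//.
exact: upper_nthrootP.
Qed.

Definition plane_round k x := point (dyadic_round k (coord1 x)) (dyadic_round k (coord2 x)).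

Lemma coord1_point (a b : R) : coord1 (point a b) = a.
Proof. by rewrite /coord1 /point mxE. Qed.

Lemma coord2_point (a b : R) : coord2 (point a b) = b.
Proof. by rewrite /coord2 /point mxE. Qed.

Lemma disc_coord r x : disc r x -> `|coord1 x| <= r /\ `|coord2 x| <= r.
Proof.
rewrite /disc /dot /= => dx.
by split; apply: le_trans dx; rewrite -sqrtr_sqr ler_wsqrtr// -!expr2
  ?lerDl ?lerDr sqr_ge0.
Qed.

Lemma disc_round r k x : disc r x -> disc r (plane_round k x).
Proof.
rewrite /disc /dot /= => dx; apply: le_trans dx.
rewrite coord1_point coord2_point ler_wsqrtr// -!expr2.
by apply: lerD; rewrite -[leLHS]real_normK ?num_real//
  -[leRHS]real_normK ?num_real// lerXn2r ?nnegrE// normr_dyadic_round.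
Qed.

Definition coord_lipschitz (h : 'rV[R]_2 -> R) L := forall x y,
  `|h x - h y| <= L * (`|coord1 x - coord1 y| + `|coord2 x - coord2 y|).

Lemma coord_lipschitz_round h L k x : 0 <= L -> coord_lipschitz h L ->
  `|h x - h (plane_round k x)| <= L * 2 * 2 ^- k.
Proof.
move=> L0 hL; apply: le_trans (hL _ _) _.
rewrite -mulrA ler_wpM2l// coord1_point coord2_point mulr_natl mulr2n.
by apply: lerD; exact: dyadic_round_dist.
Qed.

End Dyadic.

(** * Measurability of the supremum *)

Lemma measurable_normr_ge (R : realType) d (T : measurableType d)
    (f : T -> R) (t : R) : measurable_fun setT f ->
  measurable [set w | t <= `|f w|].
Proof.
move=> mf.
have -> : [set w | t <= `|f w|] = (fun w => `|f w|) @^-1` `[t, +oo[%classic.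
  by apply/seteqP; split => w /=; rewrite in_itv/= andbT.
rewrite -[X in measurable X]setTI.
by apply: (_ : measurable_fun setT (fun w => `|f w|)) => //; exact: measurableT_comp.
Qed.

Section Sup.
Context {R : realType} {d : measure_display} {T : measurableType d}.
Variable D : T -> 'rV[R]_2 -> R.
Hypothesis mD : forall x, measurable_fun setT (D ^~ x).
Hypothesis lipD : forall w, exists2 L, 0 <= L & coord_lipschitz (D w) L.

(** A function with the Lipschitz property has the same supremum over the disc as
over the countably many dyadic points of the disc. *)
Lemma measurable_C_norm_ge r (K : R) : 0 <= r ->
  measurable [set w | (K%:E <= C_norm r (D w))%E].
Proof.
move=> r0.
(* An enumeration of the dyadic points of the disc; codes of other points are sent
   to the origin, which belongs to the disc. *)
pose pt (j : nat) : 'rV[R]_2 :=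
  if unpickle j is Some (k, (b1, m1), (b2, m2)) then
    let p := point (dyadic R k b1 m1) (dyadic R k b2 m2) in
    if `[< disc r p >] then p else 0
  else 0.
have disc0 : disc r (0 : 'rV[R]_2).
  by rewrite /disc /dot /coord1 /coord2 /= !mxE !mulr0 addr0 sqrtr0.
have disc_pt j : disc r (pt j).
  rewrite /pt; case: unpickle => [[[k [b1 m1]] [b2 m2]]|]//=.
  by case: asboolP.
have round_pt k x : disc r x -> exists j, pt j = plane_round k x.
  move=> /(disc_round k) dx; pose p1 := (coord1 x < 0, dyadic_index k (coord1 x)).
  pose p2 := (coord2 x < 0, dyadic_index k (coord2 x)).
  by exists (pickle (k, p1, p2)); rewrite /pt pickleK /=; case: asboolP.
have -> : [set w | (K%:E <= C_norm r (D w))%E]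
    = \bigcap_n \bigcup_j [set w | K - n.+1%:R^-1 <= `|D w (pt j)|].
  apply/seteqP; split => w /=.
    move=> Ksup n _.
    have : ((K - n.+1%:R^-1)%:E < C_norm r (D w))%E.
      by apply: lt_le_trans Ksup; rewrite lte_fin gtrBl invr_gt0.
    move=> /ereal_sup_gt[_ /= [x dx <-]]; rewrite lte_fin => Kx.
    have [L L0 lipL] := lipD w.
    have [k Lk] : exists k, L * 2 * 2 ^- k < `|D w x| - (K - n.+1%:R^-1).
      by apply: pow2_small; rewrite subr_gt0.
    have [j pj] := round_pt k x dx; exists j => //=; rewrite pj.
    have := le_lt_trans (coord_lipschitz_round k x L0 lipL) Lk.
    have := lerB_dist (D w x) (D w (plane_round k x)).
    by move: (n.+1%:R^-1) => q; lra.
  move=> H; apply/lee_subgt0Pr => e e0.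
  have [n ne] : exists n : nat, n.+1%:R^-1 < e.
    by have /ltr_add_invr[n] := e0; rewrite add0r => ne; exists n.
  have [j _ /= Kj] := H n I.
  apply: (@le_trans _ _ `|D w (pt j)|%:E).
    by rewrite -EFinB lee_fin; move: (n.+1%:R^-1) ne Kj => q; lra.
  by apply: ereal_sup_ubound => /=; exists (pt j).
apply: bigcapT_measurable => n; apply: bigcupT_measurable => j.
exact: measurable_normr_ge.
Qed.

Lemma measure_fin_bigcup_le (P : probability T R) (I : finType)
    (A : I -> set T) (b : R) :
  (forall i, measurable (A i)) -> (forall i, (P (A i) <= b%:E)%E) ->
  (P (\bigcup_(i in setT) A i) <= (#|I|%:R * b)%:E)%E.
Proof.
move=> mA PA.
have -> : \bigcup_(i in setT) A i = \big[setU/set0]_(i : I) A i.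
  apply/seteqP; split => w.
    by move=> [i _ Ai]; rewrite (bigD1 i)//=; left.
  elim/big_rec: _ => // i B _ IH [Ai|/IH //]; by exists i.
have : measurable (\big[setU/set0]_(i : I) A i) /\
    (P (\big[setU/set0]_(i : I) A i) <= \sum_(i : I) b%:E)%E.
  elim/big_ind2: _ => [|B x C y [mB PB] [mC PC]|i _]; first by rewrite measure0.
    split; first exact: measurableU.
    have PU := @measureU2 _ _ R P _ _ mB mC.
    by apply: (le_trans PU); exact: leeD.
  by split; [exact: mA|exact: PA].
by move=> [_]; rewrite sumEFin sumr_const mulr_natl.
Qed.

End Sup.

(** * Chaining *)

Section Numeric.
Context {R : realType}.
Implicit Types r s c : R.

(** Bernoulli's inequality, in the weak form that makes the series of the union bound
geometric. *)
Lemma succ_le_pow94 (k : nat) : k.+1%:R <= (9 / 4) ^+ k :> R.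
Proof.
elim: k => [|k IH]; first by rewrite expr0.
rewrite exprS -natr1; have : (0 : R) <= k%:R by [].
by rewrite -natr1 in IH *; lra.
Qed.

(** With [n] the number of absolute values of a coordinate on the grid of level [k],
[16 n ^+ 2] counts the pairs of consecutive roundings. The product of this number
with the [2] of the tail bound and with the [2 ^+ k.+2] that makes the bounds
summable is at most [exp (9 (k + 1) + 2 s)]. Half of the exponent
[s^2 (k + 1) / K] absorbs it, since [s^2 / (2 K) >= 11 s]; the other half is at
least [s^2 / c]. *)
Lemma union_bound_numeric r s c K (k n : nat) : 1 <= r -> r <= expR s ->
  1 <= K -> 22 * K <= s -> 2 * K <= c -> n%:R <= 2 * (2 ^+ k * r) ->
  16 * n%:R ^+ 2 * (2 * expR (- (s ^+ 2 * (9 / 4) ^+ k / K)))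
   <= expR (- (s ^+ 2 / c)) / 2 ^+ k.+2.
Proof.
move=> r1 rs K1 sK cK nr.
have n2 : n%:R ^+ 2 <= 2 ^+ (2 * k + 2) * expR s ^+ 2.
  have -> : 2 ^+ (2 * k + 2) * expR s ^+ 2 = (2 * (2 ^+ k * expR s)) ^+ 2.
    by rewrite !exprMn -exprM exprD mulnC; ring.
  rewrite lerXn2r ?nnegrE ?mulr_ge0 ?exprn_ge0 ?expR_ge0//.
  by apply: (le_trans nr); rewrite ler_pM2l// ler_pM2l ?exprn_gt0.
have e2 : 2 <= expR 1 :> R by have := expR_ge1Dx (1 : R); rewrite -natr1.
have e9 : 2 ^+ (3 * k + 9) <= expR (9 * k.+1%:R) :> R.
  have -> : 9 * k.+1%:R = 1 * (9 * k.+1)%:R :> R by rewrite mul1r natrM.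
  rewrite expRM_natr.
  apply: (@le_trans _ _ (2 ^+ (9 * k.+1))).
    by rewrite ler_weXn2l ?ler1n//; lia.
  by rewrite lerXn2r ?nnegrE ?expR_ge0.
have kb := succ_le_pow94 k.
have k1 : 1 <= k.+1%:R :> R by rewrite ler1n.
have K0 : 0 < K by apply: lt_le_trans K1.
rewrite ler_pdivlMr ?exprn_gt0//.
set e := expR (- _).
apply: (@le_trans _ _ (2 ^+ (3 * k + 9) * expR s ^+ 2 * e)).
  have -> : 2 ^+ (3 * k + 9) * expR s ^+ 2 * e
      = 16 * (2 ^+ (2 * k + 2) * expR s ^+ 2) * (2 * e) * 2 ^+ k.+2.
    have -> : (3 * k + 9 = 4 + (2 * k + 2) + 1 + k.+2)%N by clear; lia.
    by rewrite !exprD; ring.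
  rewrite ler_wpM2r ?exprn_ge0// ler_wpM2r ?mulr_ge0 ?expR_ge0//.
  by rewrite ler_wpM2l.
apply: (@le_trans _ _ (expR (9 * k.+1%:R) * expR s ^+ 2
    * expR (- (s ^+ 2 * k.+1%:R / K)))).
  apply: ler_pM; rewrite ?mulr_ge0 ?exprn_ge0 ?expR_ge0//.
    by rewrite ler_wpM2r ?exprn_ge0 ?expR_ge0.
  by rewrite ler_expR lerN2 ler_wpM2r ?invr_ge0 ?(ltW K0)// ler_wpM2l ?sqr_ge0.
rewrite -expRM_natr -!expRD ler_expR.
move: (k.+1%:R) k1 => x x1.
have s2K : 11 * s <= s ^+ 2 / (2 * K).
  rewrite ler_pdivlMr ?mulr_gt0// expr2 -mulrA mulrCA ler_wpM2l//.
    by apply: le_trans sK; rewrite mulr_ge0// ltW.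
  by lra.
have s2c : s ^+ 2 / c <= s ^+ 2 / (2 * K).
  by rewrite ler_wpM2l ?sqr_ge0// lef_pV2// posrE ?mulr_gt0// (lt_le_trans _ cK)// mulr_gt0.
have -> : s ^+ 2 * x / K = 2 * (s ^+ 2 / (2 * K) * x) by field; rewrite gt_eqF.
move: (s ^+ 2 / (2 * K)) (s ^+ 2 / c) s2K s2c => A B sA BA.
have h1 : 11 * s * x <= A * x by rewrite ler_wpM2r// (le_trans _ x1).
have h2 : s <= s * x by rewrite ler_peMr//; lra.
have h3 : A <= A * x by rewrite ler_peMr//; lra.
have h4 : x <= s * x by rewrite ler_peMl//; lra.
lra.
Qed.

End Numeric.

(** One scale [sigma] serves for the values of the field in the square of half-side [r]
and for its increments per unit of distance; [K] absorbs the numerical constants. *)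
Section Chaining.
Context {R : realType} {d : measure_display} {T : measurableType d}.
Variable D : T -> 'rV[R]_2 -> R.
Hypothesis mD : forall x, measurable_fun setT (D ^~ x).
Hypothesis lipD : forall w, exists2 L, 0 <= L & coord_lipschitz (D w) L.
Variables (P : probability T R) (sigma K r : R).

Definition in_square (x : 'rV[R]_2) := `|coord1 x| <= r /\ `|coord2 x| <= r.

Hypothesis sigma_gt0 : 0 < sigma.
Hypothesis K_ge1 : 1 <= K.
Hypothesis r_ge1 : 1 <= r.
Hypothesis tail : forall x t, in_square x -> 0 < t ->
  (P [set w | (sigma * t <= `|D w x|)%R] <= (2 * expR (- (t ^+ 2 / K)))%:E)%E.
Hypothesis tail_increment : forall k x y t, in_square x -> 0 < t ->
  `|coord1 y - coord1 x| <= 2 ^- k -> `|coord2 y - coord2 x| <= 2 ^- k ->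
  (P [set w | (sigma * 2 ^- k * t <= `|D w y - D w x|)%R]
    <= (2 * expR (- (t ^+ 2 / K)))%:E)%E.

Definition grid_size k : nat := (Num.truncn (2 ^+ k * r)).+1.

(** A sign, an absolute value on the grid of level [k], and the binary digit that the
next level adds to it. *)
Definition grid_coord k : finType := (bool * 'I_(grid_size k) * bool)%type.
Definition grid_edge k : finType := (grid_coord k * grid_coord k)%type.

Definition coarse_coord k (e : grid_coord k) : R := dyadic R k e.1.1 e.1.2.
Definition fine_coord k (e : grid_coord k) : R :=
  dyadic R k.+1 e.1.1 (2 * e.1.2 + e.2).
Definition coarse_end k (e : grid_edge k) : 'rV[R]_2 :=
  point (coarse_coord e.1) (coarse_coord e.2).
Definition fine_end k (e : grid_edge k) : 'rV[R]_2 :=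
  point (fine_coord e.1) (fine_coord e.2).

Lemma coarse_coord_le k (e : grid_coord k) : `|coarse_coord e| <= r.
Proof.
rewrite normr_dyadic ler_pdivrMr ?exprn_gt0// mulrC.
apply: (@le_trans _ _ (Num.truncn (2 ^+ k * r))%:R).
  by rewrite ler_nat -ltnS ltn_ord.
by rewrite truncn_le// mulr_ge0 ?exprn_ge0// (le_trans _ r_ge1).
Qed.

Lemma in_square_coarse_end k (e : grid_edge k) : in_square (coarse_end e).
Proof.
by split; rewrite ?coord1_point ?coord2_point; exact: coarse_coord_le.
Qed.

Lemma grid_size_le k : (grid_size k)%:R <= 2 * (2 ^+ k * r).
Proof.
have t1 : 1 <= 2 ^+ k * r.
  apply: (le_trans r_ge1); rewrite ler_peMl ?(le_trans _ r_ge1)//.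
  by rewrite exprn_ege1 ?ler1n.
rewrite /grid_size -natr1 mulr_natl mulr2n lerD// truncn_le//.
exact: le_trans t1.
Qed.

Lemma card_grid_edge k : #|grid_edge k|%:R = 16 * (grid_size k)%:R ^+ 2 :> R.
Proof. by rewrite !card_prod card_bool card_ord !natrM; ring. Qed.

Lemma grid_coord_exists k (t : R) : `|t| <= r ->
  exists e : grid_coord k,
    coarse_coord e = dyadic_round k t /\ fine_coord e = dyadic_round k.+1 t.
Proof.
move=> tr; have [b bE] := dyadic_index_succ k t.
have m_lt : (dyadic_index k t < grid_size k)%N.
  by rewrite ltnS le_truncn// ler_pM2l ?exprn_gt0.
exists (t < 0, Ordinal m_lt, b); split => //.
by rewrite /fine_coord /= -bE.
Qed.

Variable s : R.

Definition base_exceedance : set T := \bigcup_(e in [set: grid_edge 0])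
  [set w | sigma * (s / 2) <= `|D w (coarse_end e)|].
(** The threshold for the increments decreases like [(3/4)^k], more slowly than
their scale [2 ^- k]: measured in standard deviations it grows like [(3/2)^k],
while it remains summable. *)
Definition level_exceedance k : set T := \bigcup_(e in [set: grid_edge k])
  [set w | sigma * 2 ^- k * (s * (3 / 2) ^+ k / 8)
           <= `|D w (fine_end e) - D w (coarse_end e)|].
Definition exceedance n : set T := if n is k.+1 then level_exceedance k else base_exceedance.

Hypothesis s_gt0 : 0 < s.

(** Telescoping along the roundings: the base point takes half of [sigma * s], and the
increments of all levels take the other half, because the series of
[(3/4)^k / 8] sums to [1/2]. *)
Lemma le_off_exceedances w x : (forall n, ~ exceedance n w) -> disc r x -> `|D w x| <= sigma * s.
Proof.
move=> good dx; have [x1 x2] := disc_coord dx.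
have edge k : exists e : grid_edge k,
    coarse_end e = plane_round k x /\ fine_end e = plane_round k.+1 x.
  have [e1 [c1 f1]] := grid_coord_exists k x1.
  have [e2 [c2 f2]] := grid_coord_exists k x2.
  by exists (e1, e2); rewrite /coarse_end /fine_end /= c1 c2 f1 f2.
have round_le k : `|D w (plane_round k x)|
    <= sigma * s * (1 - (3 / 4) ^+ k / 2).
  elim: k => [|k IH].
    have [e [<- _]] := edge 0%N.
    rewrite expr0; have -> : sigma * s * (1 - 1 / 2) = sigma * (s / 2) by field.
    by rewrite leNgt; apply/negP => /ltW h; apply: (good 0%N); exists e.
  have [e [ce fe]] := edge k.
  have step : `|D w (plane_round k.+1 x) - D w (plane_round k x)|
      <= sigma * s * ((3 / 4) ^+ k / 8).
    have -> : sigma * s * ((3 / 4) ^+ k / 8)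
        = sigma * 2 ^- k * (s * (3 / 2) ^+ k / 8).
      have -> : 3 / 4 = 2^-1 * (3 / 2) :> R by field.
      by rewrite exprMn exprVn; ring.
    rewrite -ce -fe leNgt; apply/negP => /ltW h.
    by apply: (good k.+1); exists e.
  have := ler_normD (D w (plane_round k.+1 x) - D w (plane_round k x))
    (D w (plane_round k x)).
  rewrite subrK => /le_trans; apply.
  apply: (le_trans (lerD step IH)).
  by rewrite -mulrDr exprS ler_wpM2l ?mulr_ge0 ?(ltW sigma_gt0) ?(ltW s_gt0)//; lra.
(* The roundings converge to the point, so the bound passes to the limit. *)
have [L L0 lipL] := lipD w.
rewrite leNgt; apply/negP => Dx.
have [k Lk] : exists k, L * 2 * 2 ^- k < `|D w x| - sigma * s.
  by apply: pow2_small; rewrite subr_gt0.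
have h1 := le_lt_trans (coord_lipschitz_round k x L0 lipL) Lk.
have h2 := lerB_dist (D w x) (D w (plane_round k x)).
have h3 : `|D w (plane_round k x)| <= sigma * s.
  apply: le_trans (round_le k) _.
  by rewrite ler_piMr ?mulr_ge0 ?(ltW sigma_gt0) ?(ltW s_gt0)// gerBl divr_ge0// exprn_ge0.
lra.
Qed.

Lemma measurable_exceedance n : measurable (exceedance n).
Proof.
case: n => [|k]; apply: fin_bigcup_measurable; try exact: finite_finset.
  by move=> e _; exact: measurable_normr_ge.
by move=> e _; apply: measurable_normr_ge; exact: measurable_funB.
Qed.

Variable c : R.
Hypothesis r_le : r <= expR s.
Hypothesis s_large : 22 * (64 * K) <= s.
Hypothesis c_large : 2 * (64 * K) <= c.

Lemma union_bound k (A : grid_edge k -> set T) t :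
  (forall e, measurable (A e)) -> s ^+ 2 * (9 / 4) ^+ k / (64 * K) <= t ^+ 2 / K ->
  (forall e, (P (A e) <= (2 * expR (- (t ^+ 2 / K)))%:E)%E) ->
  (P (\bigcup_(e in [set: grid_edge k]) A e)
    <= (expR (- (s ^+ 2 / c)) / 2 ^+ k.+2)%:E)%E.
Proof.
move=> mA st PA; apply: (le_trans (measure_fin_bigcup_le mA PA)).
rewrite lee_fin card_grid_edge.
have K64 : 1 <= 64 * K by apply: (le_trans K_ge1); rewrite ler_peMl ?ler1n// (le_trans _ K_ge1).
apply: le_trans (union_bound_numeric r_ge1 r_le K64 s_large c_large (grid_size_le k)).
by rewrite !ler_wpM2l ?mulr_ge0 ?exprn_ge0// ler_expR lerN2.
Qed.

(** The bound is halved from one event to the next, so that the sum over all of them is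
controlled. *)
Lemma exceedance_small n :
  (P (exceedance n) <= (expR (- (s ^+ 2 / c)) / 2 ^+ n.+1)%:E)%E.
Proof.
have K0 : 0 < K by apply: lt_le_trans K_ge1.
case: n => [|k].
  apply: (@le_trans _ _ (expR (- (s ^+ 2 / c)) / 2 ^+ 2)%:E).
    apply: (@union_bound 0 _ (s / 2)).
    - by move=> e; exact: measurable_normr_ge.
    - have -> : s ^+ 2 * (9 / 4) ^+ 0 / (64 * K) = s ^+ 2 / K / 64.
        by rewrite expr0; field; rewrite gt_eqF.
      have -> : (s / 2) ^+ 2 / K = s ^+ 2 / K / 4 by field; rewrite gt_eqF.
      by rewrite ler_wpM2l ?divr_ge0 ?exprn_ge0 ?(ltW K0) ?(ltW s_gt0)// lef_pV2 ?posrE// ler_nat.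
    - move=> e; apply: tail; first exact: in_square_coarse_end.
      by rewrite divr_gt0.
  by rewrite lee_fin ler_wpM2l ?expR_ge0// lef_pV2 ?posrE ?exprn_gt0// ler_weXn2l ?ler1n.
apply: (@union_bound k _ (s * (3 / 2) ^+ k / 8)).
- by move=> e; apply: measurable_normr_ge; exact: measurable_funB.
- have -> : 9 / 4 = (3 / 2) ^+ 2 :> R by field.
  by rewrite -exprM mulnC exprM le_eqVlt; apply/orP; left; apply/eqP; field; rewrite gt_eqF.
- move=> e; apply: tail_increment; first exact: in_square_coarse_end.
  + by rewrite divr_gt0// mulr_gt0// exprn_gt0// divr_gt0.
  + by rewrite !coord1_point; exact: dyadic_step.
  + by rewrite !coord2_point; exact: dyadic_step.
Qed.

(** Off the exceptional events the supremum is at most [sigma * s], hence less than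
[2 * sigma * s]. *)
Lemma sup_tail :
  (P [set w | ((2 * sigma * s)%:E <= C_norm r (D w))%E]
   <= (expR (- (s ^+ 2 / c)))%:E)%E.
Proof.
have r0 : 0 <= r by apply: le_trans r_ge1.
have mS := measurable_C_norm_ge mD lipD (2 * sigma * s) r0.
have sub : [set w | ((2 * sigma * s)%:E <= C_norm r (D w))%E]
    `<=` \bigcup_n exceedance n.
  move=> w /= Dw; apply: contrapT => nbad.
  have good n : ~ exceedance n w by move=> bw; apply: nbad; exists n.
  have : (C_norm r (D w) <= (sigma * s)%:E)%E.
    apply: ge_ereal_sup => _ [x dx <-]; rewrite lee_fin; exact: le_off_exceedances.
  move=> /(le_trans Dw); rewrite lee_fin -mulrA ger_pMl ?mulr_gt0//.
  by rewrite leNgt ltr1n.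
apply: (le_trans (measure_sigma_subadditive P measurable_exceedance mS sub)).
apply: le_trans (epsilon_trick0 xpredT (expR_ge0 (- (s ^+ 2 / c)))).
apply: lee_nneseries => [n _ _|n _]; first exact: measure_ge0.
by rewrite natrX; exact: exceedance_small.
Qed.

End Chaining.

(** * Increments of trigonometric differences *)

Section Trig.
Variable R : realType.
Implicit Types a b u v : R.

Lemma cos_lipschitz a b : `|cos a - cos b| <= `|a - b|.
Proof.
wlog ab : a b / a <= b => [H|].
  have [/H//|/ltW /H] := leP a b.
  by rewrite distrC [X in _ <= X]distrC.
have der (x : R) : x \in `]a, b[%R -> is_derive x 1 (@cos R) (- sin x).
  by move=> _; exact: is_derive_cos.
have [|c _ E] := MVT_segment ab der.
  by apply: continuous_subspaceT => x; exact: continuous_cos.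
rewrite distrC E normrM normrN [X in _ <= X]distrC ler_piMl//.
exact: sin_max.
Qed.

Lemma sin_lipschitz a b : `|sin a - sin b| <= `|a - b|.
Proof.
rewrite -!cosBpihalf; apply: le_trans (cos_lipschitz _ _) _.
by rewrite opprB addrA subrK.
Qed.

(** The second difference of the cosine is controlled by the product of the distance
[eta] between the two points and the common displacement [delta], plus the
difference [zeta] of the displacements: the addition formula separates the two
effects. *)
Lemma cos_increment a b a' b' (eta delta zeta : R) :
  `|a - b| <= eta -> `|a' - a| <= delta ->
  `|(a' - a) - (b' - b)| <= zeta ->
  `|(cos a' - cos b') - (cos a - cos b)| <= 2 * (eta * delta) + 2 * zeta.
Proof.
move=> Hab Hu Huv; set u := a' - a in Hu Huv; set v := b' - b in Huv.
have -> : a' = a + u by rewrite /u addrC subrK.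
have -> : b' = b + v by rewrite /v addrC subrK.
rewrite (cosD a u) (cosD b v).
have -> : cos a * cos u - sin a * sin u - (cos b * cos v - sin b * sin v)
    - (cos a - cos b)
  = (cos a - cos b) * (cos u - cos 0) + cos b * (cos u - cos v)
    - (sin a - sin b) * (sin u - sin 0) - sin b * (sin u - sin v).
  by rewrite cos0 sin0; ring.
have p1 : `|(cos a - cos b) * (cos u - cos 0)| <= eta * delta.
  rewrite normrM ler_pM// (le_trans (cos_lipschitz _ _))// subr0//.
have p2 : `|cos b * (cos u - cos v)| <= zeta.
  rewrite normrM -[zeta]mul1r ler_pM ?cos_max//.
  exact: le_trans (cos_lipschitz _ _) Huv.
have p3 : `|(sin a - sin b) * (sin u - sin 0)| <= eta * delta.
  by rewrite normrM ler_pM// (le_trans (sin_lipschitz _ _))// subr0.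
have p4 : `|sin b * (sin u - sin v)| <= zeta.
  rewrite normrM -[zeta]mul1r ler_pM ?sin_max//.
  exact: le_trans (sin_lipschitz _ _) Huv.
apply: le_trans (ler_normB _ _) _; apply: le_trans (lerD (ler_normB _ _) p4) _.
have := ler_normD ((cos a - cos b) * (cos u - cos 0)) (cos b * (cos u - cos v)).
by move: p1 p2 p3 p4; lra.
Qed.

(** The sine is a translate of the cosine, and all three bounds are invariant under
translation. *)
Lemma sin_increment a b a' b' (eta delta zeta : R) :
  `|a - b| <= eta -> `|a' - a| <= delta ->
  `|(a' - a) - (b' - b)| <= zeta ->
  `|(sin a' - sin b') - (sin a - sin b)| <= 2 * (eta * delta) + 2 * zeta.
Proof.
move=> Hab Hu Huv; rewrite -!cosBpihalf; apply: cos_increment.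
- by rewrite opprB addrA subrK.
- by rewrite opprB addrA subrK.
- by rewrite !opprB !addrA !subrK -addrA addrCA; congr (`| _ | <= _): Huv; ring.
Qed.

End Trig.

(** * Perturbation of the frequencies *)

(** The change of a trigonometric field with Gaussian coefficients when the frequency
[z u] replaces the nearby basis vector: [U] indexes the frequencies, [vertical] tells which of the
two basis vectors is close to [z u], and the left and right summands of [U + U]
index the cosine and the sine coefficients. *)
Section Field.
Context {R : realType} {d : measure_display} {T : measurableType d}.
Variables (P : probability T R) (U : finType) (v eps : R).
Variable X : U + U -> {RV P >-> R}.
Variables (vertical : U -> bool) (z : U -> 'rV[R]_2).

Definition axis_coord u (x : 'rV[R]_2) : R :=
  if vertical u then coord2 x else coord1 x.

Definition coef (k : U + U) (x : 'rV[R]_2) : R :=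
  Num.sqrt 2 / 2 * match k with
  | inl u => cos (axis_coord u x) - cos (dot x (z u))
  | inr u => sin (axis_coord u x) - sin (dot x (z u)) end.

Definition diff_field (w : T) (x : 'rV[R]_2) : R := \sum_k coef k x * X k w.

Hypothesis mgfX : gaussian_mgf v X.
Hypothesis vU : v * #|U|%:R = 2.
Hypothesis eps_gt0 : 0 < eps.
Hypothesis z_near_axis : forall u x,
  `|axis_coord u x - dot x (z u)| <= eps * (`|coord1 x| + `|coord2 x|).

(** The [2 #|U|] coefficients have total variance [4], and the square of the factor
[sqrt 2 / 2] halves it. *)
Lemma variance_le (c : U + U -> R) (B : R) :
  (forall k, `|c k| <= Num.sqrt 2 / 2 * B) ->
  v * (\sum_k c k ^+ 2) <= 2 * B ^+ 2.
Proof.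
move=> cB.
have c2 k : c k ^+ 2 <= B ^+ 2 / 2.
  have -> : B ^+ 2 / 2 = (Num.sqrt 2 / 2 * B) ^+ 2.
    by rewrite !exprMn sqr_sqrtr// exprVn; field.
  by rewrite -[leLHS]real_normK ?num_real// lerXn2r ?nnegrE// (le_trans _ (cB k)).
have v0 : 0 <= v.
  rewrite leNgt; apply/negP => v0; have : v * #|U|%:R <= 0 by rewrite mulr_le0_ge0// ltW.
  by rewrite vU leNgt ltr0n.
apply: (@le_trans _ _ (v * \sum_(k : U + U) B ^+ 2 / 2)).
  by rewrite ler_wpM2l// ler_sum.
rewrite sumr_const card_sum -[_ *+ (_ + _)]mulr_natr natrD.
have -> : v * (B ^+ 2 / 2 * (#|U|%:R + #|U|%:R)) = v * #|U|%:R * B ^+ 2 by field.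
by rewrite vU.
Qed.

Lemma measurable_diff_field x : measurable_fun setT (diff_field ^~ x).
Proof. exact: measurable_lincomb. Qed.

Lemma dotB x y (y0 : 'rV[R]_2) : dot (x - y) y0 = dot x y0 - dot y y0.
Proof. by rewrite /dot /coord1 /coord2 !mxE; ring. Qed.

Lemma axis_coordB u x y : axis_coord u (x - y) = axis_coord u x - axis_coord u y.
Proof. by rewrite /axis_coord /coord1 /coord2; case: ifP => _; rewrite !mxE. Qed.

Lemma axis_coord_le u x b : `|coord1 x| <= b -> `|coord2 x| <= b ->
  `|axis_coord u x| <= b.
Proof. by rewrite /axis_coord; case: ifP. Qed.

Let h0 : 0 <= Num.sqrt 2 / 2 :> R.
Proof. by rewrite divr_ge0 ?sqrtr_ge0. Qed.

Lemma coef_le k x r : in_square r x ->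
  `|coef k x| <= Num.sqrt 2 / 2 * (2 * (eps * r)).
Proof.
move=> [x1 x2]; rewrite normrM ger0_norm// ler_wpM2l//.
have zx u : `|axis_coord u x - dot x (z u)| <= 2 * (eps * r).
  apply: le_trans (z_near_axis u x) _.
  by rewrite mulrCA ler_wpM2l ?(ltW eps_gt0)// mulr_natl mulr2n lerD.
by case: k => u; [apply: le_trans (cos_lipschitz _ _) _
                 |apply: le_trans (sin_lipschitz _ _) _].
Qed.

Lemma coef_increment k x y r (delta : R) : in_square r x -> 1 <= r ->
  `|coord1 y - coord1 x| <= delta -> `|coord2 y - coord2 x| <= delta ->
  `|coef k y - coef k x| <= Num.sqrt 2 / 2 * (8 * (eps * r * delta)).
Proof.
move=> [x1 x2] r1 d1 d2; rewrite /coef -mulrBr normrM ger0_norm// ler_wpM2l//.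
have d0 : 0 <= delta by apply: le_trans d1.
have zx u : `|axis_coord u x - dot x (z u)| <= 2 * (eps * r).
  apply: le_trans (z_near_axis u x) _.
  by rewrite mulrCA ler_wpM2l ?(ltW eps_gt0)// mulr_natl mulr2n lerD.
have cxy : coord1 (y - x) = coord1 y - coord1 x /\ coord2 (y - x) = coord2 y - coord2 x.
  by rewrite /coord1 /coord2 !mxE.
have ux u : `|axis_coord u y - axis_coord u x| <= delta.
  by rewrite -axis_coordB; apply: axis_coord_le; rewrite (cxy.1, cxy.2).
have uvx u : `|axis_coord u y - axis_coord u x - (dot y (z u) - dot x (z u))|
    <= 2 * (eps * delta).
  rewrite -axis_coordB -dotB; apply: le_trans (z_near_axis u _) _.
  by rewrite mulrCA ler_wpM2l ?(ltW eps_gt0)// mulr_natl mulr2n cxy.1 cxy.2 lerD.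
have fin : 2 * (2 * (eps * r) * delta) + 2 * (2 * (eps * delta))
    <= 8 * (eps * r * delta).
  have : eps * delta <= eps * r * delta.
    by rewrite ler_wpM2r// ler_peMr// ltW.
  by lra.
by case: k => u; apply: le_trans fin; [exact: cos_increment|exact: sin_increment].
Qed.

Lemma diff_field_coord_lipschitz w : exists2 L, 0 <= L & coord_lipschitz (diff_field w) L.
Proof.
exists (\sum_k (Num.sqrt 2 / 2 * (2 + eps)) * `|X k w|).
  by apply: sumr_ge0 => k _; rewrite !mulr_ge0// addr_ge0// ltW.
move=> x y; rewrite /diff_field -sumrB mulr_suml.
apply: le_trans (ler_norm_sum _ _ _) _; apply: ler_sum => k _.
rewrite -mulrBl normrM mulrAC ler_wpM2r// /coef -mulrBr normrM ger0_norm//.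
rewrite -[X in _ <= X]mulrA ler_wpM2l//.
set m := `|coord1 x - coord1 y| + _.
have cxy : coord1 (x - y) = coord1 x - coord1 y /\ coord2 (x - y) = coord2 x - coord2 y.
  by rewrite /coord1 /coord2 !mxE.
have ax u : `|axis_coord u x - axis_coord u y| <= m.
  rewrite -axis_coordB; apply: axis_coord_le; rewrite ?cxy.1 ?cxy.2.
    by rewrite lerDl.
  by rewrite lerDr.
have dz u : `|dot x (z u) - dot y (z u)| <= (1 + eps) * m.
  rewrite -dotB; have := z_near_axis u (x - y).
  rewrite cxy.1 cxy.2 -/m axis_coordB => zc.
  have := ler_distD (axis_coord u x - axis_coord u y) 0 (dot (x - y) (z u)).
  rewrite !sub0r !normrN => /le_trans; apply.
  by rewrite mulrDl mul1r lerD.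
have fin (p q p' q' : R) : `|p - p'| <= m -> `|q - q'| <= (1 + eps) * m ->
    `|p - q - (p' - q')| <= (2 + eps) * m.
  move=> H1 H2; have -> : p - q - (p' - q') = (p - p') - (q - q') by ring.
  apply: le_trans (ler_normB _ _) _; apply: (le_trans (lerD H1 H2)); lra.
case: k => u; apply: fin.
- exact: le_trans (cos_lipschitz _ _) _.
- exact: le_trans (cos_lipschitz _ _) _.
- exact: le_trans (sin_lipschitz _ _) _.
- exact: le_trans (sin_lipschitz _ _) _.
Qed.

(** The coefficients bound the variance by [8 (eps r)^2], well within
[(12 eps r)^2]; the factor [12] is the one that the increments need. *)
Lemma diff_field_tail r x t : 1 <= r -> in_square r x -> 0 < t ->
  (P [set w | (eps * r * t <= `|diff_field w x|)%R]
    <= (2 * expR (- (t ^+ 2 / (2 * 12 ^+ 2))))%:E)%E.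
Proof.
move=> r1 sx t0.
have r0 : 0 < r by apply: lt_le_trans r1.
pose s : R := 12 * (eps * r).
have er0 : 0 < eps * r by rewrite mulr_gt0.
have s0 : 0 < s by rewrite mulr_gt0.
have var : v * (\sum_k coef k x ^+ 2) <= s ^+ 2.
  apply: le_trans (variance_le (fun k => coef_le k sx)) _.
  by rewrite /s; have := sqr_ge0 (eps * r); rewrite !exprMn; lra.
have := gaussian_tail mgfX s0 (mulr_gt0 er0 t0) var.
move=> /le_trans; apply; rewrite lee_fin ler_wpM2l// ler_expR.
rewrite le_eqVlt; apply/orP; left; apply/eqP; rewrite /s.
by field; rewrite !gt_eqF.
Qed.

(** The variance is at most [2 * 8 ^+ 2 = 128] times the square of the scale, and
[128 <= 12 ^+ 2]. *)
Lemma diff_field_tail_increment r k x y t : 1 <= r -> in_square r x -> 0 < t ->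
  `|coord1 y - coord1 x| <= 2 ^- k -> `|coord2 y - coord2 x| <= 2 ^- k ->
  (P [set w | (eps * r * 2 ^- k * t <= `|diff_field w y - diff_field w x|)%R]
    <= (2 * expR (- (t ^+ 2 / (2 * 12 ^+ 2))))%:E)%E.
Proof.
move=> r1 sx t0 d1 d2.
have r0 : 0 < r by apply: lt_le_trans r1.
pose s : R := 12 * (eps * r * 2 ^- k).
have er0 : 0 < eps * r * 2 ^- k by rewrite !mulr_gt0// invr_gt0 exprn_gt0.
have s0 : 0 < s by rewrite mulr_gt0.
have var : v * (\sum_k (coef k y - coef k x) ^+ 2) <= s ^+ 2.
  apply: le_trans (variance_le (fun k => coef_increment k sx r1 d1 d2)) _.
  rewrite /s; have := sqr_ge0 (eps * r * 2 ^- k); move: (eps * r * 2 ^- k) => q.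
  by rewrite !exprMn; lra.
have := gaussian_tail mgfX s0 (mulr_gt0 er0 t0) var.
under eq_set do under eq_bigr do rewrite mulrBl.
under eq_set do rewrite sumrB.
move=> /le_trans; apply; rewrite lee_fin ler_wpM2l// ler_expR.
rewrite le_eqVlt; apply/orP; left; apply/eqP; rewrite /s.
move: (eps * r * 2 ^- k) er0 => q q0.
by field; rewrite !gt_eqF.
Qed.

End Field.

(** * Frequencies near the axes *)

Section Geometry.
Variable R : realType.
Implicit Types (x : 'rV[R]_2) (phi eps : R).

(** The cosine and the sine are Lipschitz, and the point at angle [phi] differs from the
one at angle [0] by [(1 - cos phi, - sin phi)]. *)
Lemma dot_near_axis phi eps : `|phi| <= eps ->
  forall a b : R, `|a - (a * cos phi + b * sin phi)| <= eps * (`|a| + `|b|).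
Proof.
move=> pe a b.
have -> : a - (a * cos phi + b * sin phi)
    = a * (cos 0 - cos phi) - b * (sin phi - sin 0).
  by rewrite cos0 sin0; ring.
apply: le_trans (ler_normB _ _) _; rewrite !normrM mulrDr ![eps * _]mulrC.
apply: lerD; rewrite ler_wpM2l//.
  by apply: le_trans (cos_lipschitz _ _) _; rewrite sub0r normrN.
by apply: le_trans (sin_lipschitz _ _) _; rewrite subr0.
Qed.

Lemma circle_point_close eps phi x : `|phi| <= eps ->
  `|coord1 x - dot x (circle_point phi)| <= eps * (`|coord1 x| + `|coord2 x|).
Proof.
by move=> pe; rewrite /dot coord1_point coord2_point; exact: dot_near_axis.
Qed.

Lemma rotated_circle_point_close eps phi x : `|phi| <= eps ->
  `|coord2 x - dot x (rotation (pi / 2) (circle_point phi))|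
    <= eps * (`|coord1 x| + `|coord2 x|).
Proof.
move=> pe; have := dot_near_axis pe (coord2 x) (- coord1 x).
rewrite normrN [`|coord2 x| + _]addrC; congr (`|_| <= _).
rewrite /dot /rotation !coord1_point !coord2_point cos_pihalf sin_pihalf.
by ring.
Qed.

End Geometry.

(** * The coupling *)

Section Halves.
Variable M : nat.

Lemma mul2n_add : (2 * M = M + M)%N. Proof. by rewrite mul2n addnn. Qed.

Definition to_halves (j : 'I_(2 * M)) : 'I_M + 'I_M :=
  fintype.split (cast_ord mul2n_add j).
Definition of_halves (u : 'I_M + 'I_M) : 'I_(2 * M) :=
  cast_ord (esym mul2n_add) (unsplit u).

Lemma to_halvesK : cancel to_halves of_halves.
Proof. by move=> j; rewrite /to_halves /of_halves splitK cast_ordK. Qed.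

Lemma of_halvesK : cancel of_halves to_halves.
Proof. by move=> u; rewrite /to_halves /of_halves cast_ordKV unsplitK. Qed.

End Halves.

(** Four independent copies of a system of [M] Gaussians whose total variance is [1]. The
outer sum type separates cosine from sine coefficients, the inner one the
frequencies near the first axis from those near the second. *)
Section Coupling.
Context {R : realType} {d : measure_display} {T : measurableType d}.
Variables (P : probability T R) (M : nat) (v : R).
Variable X : 'I_M -> {RV P >-> R}.
Hypothesis sysX : gaussian_system v X.
Hypothesis v_gt0 : 0 < v.
Hypothesis M_gt0 : (0 < M)%N.
Hypothesis vM : v * M%:R = 1.

Let PP := prod_prob P P.
Let Q := prod_prob PP PP.

Definition blocks : ('I_M + 'I_M) + ('I_M + 'I_M) -> {RV Q >-> R} :=
  join_prod (join_prod X X) (join_prod X X).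

(** A family with one member, so that [iid_prod] applies to it. *)
Definition block_sum (_ : 'I_1) : {RV P >-> R} := rv_of P (measurable_rv_sum X).

Definition block_sums : ('I_1 + 'I_1) + ('I_1 + 'I_1) -> {RV Q >-> R} :=
  join_prod (join_prod block_sum block_sum) (join_prod block_sum block_sum).

Lemma system_blocks : gaussian_system v blocks.
Proof.
have c1 : (0 < #|'I_M|)%N by rewrite card_ord.
have c2 : (0 < #|{: 'I_M + 'I_M}|)%N by rewrite card_sum card_ord addn_gt0 M_gt0.
by do 2 apply: system_prod => //.
Qed.

Lemma iid_block_sum : iid_centred_gaussian 1 block_sum.
Proof.
split; first exact: independent_ord1.
by move=> i A mA; have := system_sum sysX mA; rewrite card_ord vM.
Qed.

Lemma iid_block_sums : iid_centred_gaussian 1 block_sums.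
Proof. by do 2 apply: iid_prod; exact: iid_block_sum. Qed.

Definition axis_block (i : 'I_2) : 'I_1 + 'I_1 :=
  if i == ord0 then inl ord0 else inr ord0.

Lemma axis_block_inj : injective axis_block.
Proof.
by move=> i j; rewrite /axis_block; case: eqP => [->|/eqP i0]; case: eqP => [->|/eqP j0]//;
  move=> _; apply/val_inj; move: i i0 j j0 => [[|[|i]]//= ?] _ [[|[|j]]//= ?].
Qed.

Definition block_beta i := block_sums (inl (axis_block i)).
Definition block_gamma i := block_sums (inr (axis_block i)).
Definition cos_coef j := blocks (inl (to_halves j)).
Definition sin_coef j := blocks (inr (to_halves j)).

Lemma iid_block_beta_gamma : iid_centred_gaussian 1 (join_families block_beta block_gamma).
Proof.
pose f (k : 'I_2 + 'I_2) : ('I_1 + 'I_1) + ('I_1 + 'I_1) :=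
  match k with inl i => inl (axis_block i) | inr i => inr (axis_block i) end.
have -> : join_families block_beta block_gamma = (fun k => block_sums (f k)).
  by apply/funext => -[].
apply: iid_reindex; last exact: iid_block_sums.
by move=> [i|i] [j|j] //= [/axis_block_inj ->].
Qed.

Lemma iid_cos_sin_coef : iid_centred_gaussian v (join_families cos_coef sin_coef).
Proof.
pose f (k : 'I_(2 * M) + 'I_(2 * M)) : ('I_M + 'I_M) + ('I_M + 'I_M) :=
  match k with inl i => inl (to_halves i) | inr i => inr (to_halves i) end.
have -> : join_families cos_coef sin_coef = (fun k => blocks (f k)).
  by apply/funext => -[].
apply: iid_reindex; last exact: system_iid system_blocks.
by move=> [i|i] [j|j] //= [/(can_inj (@to_halvesK M)) ->].
Qed.

Variable z : 'I_(2 * M) -> 'rV[R]_2.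

Definition coupled_F (w : (T * T) * (T * T)) (x : 'rV[R]_2) : R :=
  Num.sqrt 2 / 2 *
    (block_beta ord0 w * cos (coord1 x) + block_gamma ord0 w * sin (coord1 x)
     + block_beta ord_max w * cos (coord2 x) + block_gamma ord_max w * sin (coord2 x)).

Definition coupled_G (w : (T * T) * (T * T)) (x : 'rV[R]_2) : R :=
  Num.sqrt 2 / 2 *
    ((\sum_(j < 2 * M) cos_coef j w * cos (dot x (z j)))
     + (\sum_(j < 2 * M) sin_coef j w * sin (dot x (z j)))).

Definition second_half (u : 'I_M + 'I_M) : bool := if u is inr _ then true else false.

(** Each coefficient of [coupled_F] is the sum of the coefficients of [coupled_G] over the
corresponding block, so the difference is taken frequency by frequency. *)
Lemma coupled_diff w x : coupled_F w x - coupled_G w x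
  = diff_field blocks second_half (fun u => z (of_halves u)) w x.
Proof.
have betaE : block_beta ord0 w = \sum_i blocks (inl (inl i)) w by [].
have betaE' : block_beta ord_max w = \sum_i blocks (inl (inr i)) w by [].
have gammaE : block_gamma ord0 w = \sum_i blocks (inr (inl i)) w by [].
have gammaE' : block_gamma ord_max w = \sum_i blocks (inr (inr i)) w by [].
have bE : \sum_(j < 2 * M) cos_coef j w * cos (dot x (z j))
    = \sum_u blocks (inl u) w * cos (dot x (z (of_halves u))).
  rewrite (reindex (@of_halves M)) /=; last first.
    by exists (@to_halves M) => j _; [exact: of_halvesK|exact: to_halvesK].
  by apply: eq_bigr => u _; rewrite /cos_coef of_halvesK.
have cE : \sum_(j < 2 * M) sin_coef j w * sin (dot x (z j))
    = \sum_u blocks (inr u) w * sin (dot x (z (of_halves u))).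
  rewrite (reindex (@of_halves M)) /=; last first.
    by exists (@to_halves M) => j _; [exact: of_halvesK|exact: to_halvesK].
  by apply: eq_bigr => u _; rewrite /sin_coef of_halvesK.
rewrite /coupled_F /coupled_G /diff_field bE cE betaE betaE' gammaE gammaE'.
rewrite !big_sumType /coef /axis_coord /=.
rewrite -mulrBr.
have E (A : 'I_M -> R) (k : R) (B : 'I_M -> R) :
    \sum_i Num.sqrt 2 / 2 * (k - B i) * A i
    = Num.sqrt 2 / 2 * ((\sum_i A i) * k - \sum_i A i * B i).
  rewrite mulr_suml -sumrB mulr_sumr; apply: eq_bigr => i _; ring.
rewrite !E; ring.
Qed.

End Coupling.

Theorem theorem1p8 (R : realType) :
  exists2 c : R, 0 < c &
  forall (eps : R) (M : nat) (phi : 'I_(4 * M) -> R),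
  let y (j : 'I_(4 * M)) := circle_point (phi j) in
  let Y0 := [set y j | j in [set j : 'I_(4 * M) | (j < M)%N]] in
  0 < eps ->
  (1 <= M)%N ->
  injective y ->
  (forall j : 'I_(4 * M), (j < M)%N -> - eps < phi j < eps) ->
  range y = Y0 `|` (rotation (pi / 2) @` Y0) `|` (rotation pi @` Y0)
               `|` (rotation (3 * pi / 2) @` Y0) ->
  [set y j | j in [set j : 'I_(4 * M) | (M <= j < 2 * M)%N]]
    = rotation (pi / 2) @` Y0 ->
  exists (d : measure_display) (T : measurableType d) (P : probability T R)
         (F G : T -> 'rV[R]_2 -> R),
  [/\ cilleruelo_field P F,
      trigonometric_field P (4 / (4 * M)%:R)
        (fun j : 'I_(2 * M) => y (widen_ord (leq_2M_4M M) j)) G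
    & forall r : R, 2 * c <= r ->
      (P [set w | (2 * eps * r * ln r)%:E
                    <= C_norm r (fun x => F w x - G w x)%R]
         <= (expR (- ((ln r) ^+ 2 / c)))%:E)%E /\
      (P [set w | (2 * eps * r ^+ 2)%:E
                    <= C_norm r (fun x => F w x - G w x)%R]
         <= (expR (- (r ^+ 2 / c)))%:E)%E].
Proof.
(* The tails of the difference field have the constant [K]; the factor [64] is the
   square of the [8] in the chaining thresholds, and [22] comes from
   [union_bound_numeric]. The constant is exponential in [L] because the first
   estimate needs [ln r] to be at least [L]. *)
pose K : R := 2 * 12 ^+ 2; pose L := 22 * (64 * K).
have K1 : 1 <= K by rewrite /K; lra.
have K0 : 0 < K by apply: lt_le_trans K1.
exists (expR L); first exact: expR_gt0.
move=> eps M phi y Y0 eps0 M0 _ phi_eps _ rotY.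
pose v : R := 4 / (4 * M)%:R.
have MR0 : 0 < M%:R :> R by rewrite ltr0n.
have vE : v = M%:R^-1 by rewrite /v natrM; field; rewrite gt_eqF.
have v0 : 0 < v by rewrite vE invr_gt0.
have vM : v * M%:R = 1 by rewrite vE mulVf ?gt_eqF.
have [d [T [P [X sX]]]] : exists (d : measure_display) (T : measurableType d)
    (P : probability T R) (X : 'I_M -> {RV P >-> R}), gaussian_system v X.
  by case: (M) M0 => // m _; exact: system_exists.
pose z (j : 'I_(2 * M)) := y (widen_ord (leq_2M_4M M) j).
exists _, _, (prod_prob (prod_prob P P) (prod_prob P P)), (coupled_F X), (coupled_G X z).
have sB := system_blocks sX v0 M0.
have near_axis (j : 'I_(4 * M)) : (j < M)%N -> `|phi j| <= eps.
  by move=> /phi_eps/andP[h1 h2]; rewrite ler_norml !ltW.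
have z_near_axis u x : `|axis_coord (@second_half M) u x - dot x (z (of_halves u))|
    <= eps * (`|coord1 x| + `|coord2 x|).
  case: u => i; rewrite /axis_coord /=.
    by apply: circle_point_close; apply: near_axis; rewrite /= ltn_ord.
  have : (rotation (pi / 2) @` Y0) (z (of_halves (inr i))).
    rewrite -rotY; exists (widen_ord (leq_2M_4M M) (of_halves (inr i))) => //=.
    by rewrite leq_addr mul2n -addnn ltn_add2l ltn_ord.
  move=> [_ [j /= jM <-] <-].
  by apply: rotated_circle_point_close; exact: near_axis.
have vU : v * #|{: 'I_M + 'I_M}|%:R = 2.
  by rewrite card_sum card_ord natrD mulrDr vM.
split.
- exists (block_beta X), (block_gamma X); split => //; exact: (iid_block_beta_gamma sX vM).
- by exists (cos_coef X), (sin_coef X); split => //; exact: (iid_cos_sin_coef sX v0 M0).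
move=> r cr.
have cL : 1 + L <= expR L by exact: expR_ge1Dx.
have L0 : 0 < L by rewrite /L !mulr_gt0.
have r_large : 2 * (1 + L) <= r by apply: le_trans cr; rewrite ler_pM2l.
have r1 : 1 <= r by lra.
have r0 : 0 < r by apply: lt_le_trans r1.
have ln_large : L <= ln r.
  rewrite -[L]expRK ler_ln ?posrE ?expR_gt0//; lra.
have main s : L <= s -> r <= expR s ->
    (prod_prob (prod_prob P P) (prod_prob P P) [set w | (2 * (eps * r) * s)%:E
        <= C_norm r (fun x => coupled_F X w x - coupled_G X z w x)%R]
     <= (expR (- (s ^+ 2 / expR L)))%:E)%E.
  move=> Ls rs.
  under eq_set => w do under eq_fun do rewrite coupled_diff.
  apply: (@sup_tail R _ _ _ _ _ _ (eps * r) K) => //.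
  - exact: measurable_diff_field.
  - by move=> w; exact: diff_field_coord_lipschitz eps0 z_near_axis w.
  - by rewrite mulr_gt0.
  - move=> x t sx t0.
    exact: (diff_field_tail (system_mgf sB) vU eps0 z_near_axis r1 sx t0).
  - move=> k x x' t sx t0 d1 d2.
    exact: (diff_field_tail_increment (system_mgf sB) vU eps0 z_near_axis r1 sx t0 d1 d2).
  - exact: lt_le_trans Ls.
  - apply: le_trans cL; rewrite -[leLHS]add0r lerD// ler_wpM2r ?ler_nat//.
    by rewrite mulr_ge0// ltW.
split.
  have := main (ln r) ln_large; rewrite lnK// => /(_ (lexx _)).
  by rewrite [2 * (eps * r)]mulrA.
have rL : L <= r by lra.
have := main r rL; have -> : 2 * (eps * r) * r = 2 * eps * r ^+ 2 by ring.
by apply; apply: le_trans (expR_ge1Dx r); lra.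
Qed.
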